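(* Let $X$ be a real Banach space and let $D$ be a nonempty bounded closed convex subset of $X$. Given $f\in X^*$ and $\epsilon>0$, there exists $x^*\in X^*$ with $\|x^*\|\leq\epsilon$ such that $|f+x^*|$ attains its supremum on $D$. Moreover, if $D$ is symmetric and $f(x_0)>\|f\|_D-\frac{\delta}{2}$ for some $x_0\in D$ and some $\delta>0$, then $x^*\in X^*$ and a point $x_1\in D$ can be chosen so that $\|x^*\|\leq\epsilon$, $\|x_0-x_1\|\leq\frac{\delta}{\epsilon}$, and $|f+x^*|$ attains its supremum on $D$ at $x_1$.
   Context: All Banach spaces are over $\mathbb{R}$. $D$ symmetric means $D=-D$. For $f\in X^*$, $\|f\|_D=\sup\{|f(x)|:x\in D\}$. For $g\in X^*$, $|g|$ is the function $x\mapsto|g(x)|$; it attains its supremum on $D$ at $x_1\in D$ if $|g(x_1)|=\sup_{x\in D}|g(x)|$. *)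

(* Defs.v *)
From HB Require Import structures.
From mathcomp Require Import all_boot all_order all_algebra.
From mathcomp Require Import all_classical all_reals all_analysis.

Set Implicit Arguments.
Unset Strict Implicit.
Unset Printing Implicit Defensive.

Import Order.TTheory GRing.Theory Num.Theory.
Import numFieldNormedType.Exports.

Local Open Scope classical_set_scope.
Local Open Scope ring_scope.

(* An element of the topological dual [X^*] is a [g : {linear X -> R^o}] together
   with a proof of [continuous g].  Since [sup] is a total real-valued operator
   (it is [0] on empty or unbounded sets), [sup_abs D g] is the mathematical
   supremum of [|g|] on [D] only when [D] is nonempty and [|g|] is bounded on [D];
   both hold for continuous linear [g] and nonempty bounded [D]. *)
Definition sup_abs (R : realType) (X : normedModType R) (D : set X)
    (g : X -> R) : R :=
  sup [set `|g x| | x in D].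

Definition dual_norm (R : realType) (X : normedModType R) (g : X -> R) : R :=
  sup_abs [set x : X | `|x| <= 1] g.

Definition attains_sup_abs_at (R : realType) (X : normedModType R) (D : set X)
    (g : X -> R) (x1 : X) : Prop :=
  D x1 /\ `|g x1| = sup_abs D g.

Definition attains_sup_abs (R : realType) (X : normedModType R) (D : set X)
    (g : X -> R) : Prop :=
  exists x1 : X, attains_sup_abs_at D g x1.

Definition symmetric_set (R : realType) (X : normedModType R) (D : set X) : Prop :=
  D = [set - x | x in D].

(* Main.v *)
From HB Require Import structures.
Require Import Defs.
From mathcomp Require Import all_boot all_order all_algebra.
From mathcomp Require Import all_classical all_reals all_analysis.
From mathcomp Require Import ring lra.
Import Order.TTheory GRing.Theory Num.Theory.
Import numFieldNormedType.Exports.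
Local Open Scope classical_set_scope.
Local Open Scope ring_scope.

Set Implicit Arguments.
Unset Strict Implicit.
Unset Printing Implicit Defensive.

(** The heart of the matter is a Bishop-Phelps lemma ([bishop_phelps]) with a
    quantitative control on the supporting point.  Ekeland's variational
    principle ([ekeland_maximal]) gives, from [x0] in [D], a point [x1] of [D]
    with [eps * `|x0 - x1| <= f x1 - f x0] at which the cone-perturbed
    functional [x |-> f x - eps * `|x1 - x|] is maximal on [D].  By convexity
    of [D], the set of all [t *: (x1 - x)] with [t >= 0], [x] in [D], paired
    with the values [t * (f x - f x1)], is a convex cone lying below the graph
    of the sublinear function [eps * `|_|]; the Hahn-Banach theorem, in
    Mazur-Orlicz form ([mazur_orlicz_cone]), yields a linear [g] with
    [g <= eps * `|_|] and [f x - f x1 <= g (x1 - x)] on [D], which says that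
    [f + g] is maximal on [D] at [x1].

    If [D] is symmetric, the maximum of [f + g] is also that of [|f + g|], and
    the bound on [`|x0 - x1|] comes from
    [f x1 - f x0 <= sup_abs D f - f x0 < delta / 2].

    If [D] is not symmetric ([bishop_phelps_abs]), let [h = f + g] be maximal at
    [x1] and suppose that [|h|] is not.  Then [- h] takes at some [x2] in [D] a
    value strictly larger than the maximum of [h].  Applying the lemma to [- h]
    from [x2], with a perturbation so small on the bounded set [D] that it
    cannot close the gap, produces a functional that attains its maximum on [D]
    and whose maximum still dominates that of its opposite, hence attains the
    supremum of its absolute value.

    Hahn-Banach is proved by minimality: Zorn's lemma gives a minimal sublinear
    function below a given one, and a minimal sublinear function [q] is linear,
    because lowering [q] along the ray spanned by [y] so that
    [q (- y) <= - q y] keeps it sublinear. *)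

(** * Sublinear functions and the Hahn-Banach theorem *)

(** Taking [t = 0] is allowed: together with subadditivity the inequality then
    forces [p 0 = 0] and positive homogeneity ([sublinearZ]). *)
Definition sublinear (R : realType) (E : lmodType R) (p : E -> R) : Prop :=
  (forall x y, p (x + y) <= p x + p y) /\
  (forall t x, 0 <= t -> p (t *: x) <= t * p x).

Lemma sublinear_ge (R : realType) (E : lmodType R) (p : E -> R) (x y : E) :
  sublinear p -> p x - p (- y) <= p (x + y).
Proof.
move=> [pD _]; rewrite lerBlDr.
by have := pD (x + y) (- y); rewrite addrK.
Qed.

Lemma sublinear_le0 (R : realType) (E : lmodType R) (p : E -> R) :
  sublinear p -> p 0 <= 0.
Proof. by move=> [_ pZ]; have := pZ 0 0 (lexx _); rewrite scale0r mul0r. Qed.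

Lemma sublinear_geN (R : realType) (E : lmodType R) (p : E -> R) (x : E) :
  sublinear p -> - p (- x) <= p x.
Proof.
move=> [pD pZ].
have := pD 0 0; rewrite addr0 => p0.
have := pD x (- x); rewrite subrr; lra.
Qed.

Lemma sublinearZ (R : realType) (E : lmodType R) (p : E -> R) (t : R) (x : E) :
  sublinear p -> 0 <= t -> p (t *: x) = t * p x.
Proof.
move=> sp t0; apply/eqP; rewrite eq_le sp.2//=.
have [t_gt0|] := ltP 0 t; last first.
  move=> t_le0; have -> : t = 0 by apply/eqP; rewrite eq_le t_le0.
  rewrite scale0r mul0r.
  by have := sp.1 0 0; rewrite addr0; lra.
rewrite mulrC -ler_pdivlMr// mulrC.
have := sp.2 t^-1 (t *: x); rewrite scalerA mulVf ?gt_eqF// scale1r.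
by apply; rewrite invr_ge0.
Qed.

(** Both constructions of smaller sublinear functions used below, along a chain
    and along a cone, are pointwise infima of families whose members need not be
    sublinear one by one but become so jointly, up to replacing a member by
    another one of the family. *)
Lemma inf_sublinear (R : realType) (E : lmodType R) (Q : set (E -> R)) :
  Q !=set0 ->
  (forall x, has_lbound [set q x | q in Q]) ->
  (forall q1 q2 x y, Q q1 -> Q q2 ->
    exists2 q, Q q & q (x + y) <= q1 x + q2 y) ->
  (forall q t x, Q q -> 0 <= t -> exists2 q', Q q' & q' (t *: x) <= t * q x) ->
  sublinear (fun x => inf [set q x | q in Q]).
Proof.
move=> [q0 Qq0] Qlb QD QZ.
have infle x q : Q q -> inf [set q x | q in Q] <= q x.
  by move=> Qq; apply: ge_inf => //; exists q.
have leinf x m : (forall q, Q q -> m <= q x) -> m <= inf [set q x | q in Q].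
  move=> mq; apply: lb_le_inf; first by exists (q0 x), q0.
  by move=> _ [q Qq <-]; exact: mq.
split=> [x y|t x t0] /=.
  rewrite -lerBlDr; apply: (leinf) => q1 Q1.
  rewrite lerBlDr [leRHS]addrC -lerBlDr; apply: (leinf) => q2 Q2.
  rewrite lerBlDr [leRHS]addrC.
  have [q Qq /(le_trans _)] := QD _ _ x y Q1 Q2; apply; exact: infle.
have bound q : Q q -> inf [set q (t *: x) | q in Q] <= t * q x.
  move=> Qq; have [q' Qq' /(le_trans _)] := QZ _ _ x Qq t0; apply; exact: infle.
have [t_gt0|] := ltP 0 t.
  rewrite mulrC -ler_pdivrMr//. apply: (leinf) => q Qq.
  by rewrite ler_pdivrMr// mulrC; exact: bound.
move=> t_le0; have t00 : t = 0 by lra.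
by rewrite {2}t00 mul0r; have := bound _ Qq0; rewrite {2}t00 mul0r.
Qed.

(** The function is the inf-convolution [x |-> inf (p (x + c) - r)] over the cone.
    It is finite because [r <= p c] bounds it below by [- p (- x)]; the point
    [(0, 0)] of the cone makes it at most [p], and evaluating the term [(c, r)]
    at [- c] gives the last inequality. *)
Lemma tilt_sublinear (R : realType) (E : lmodType R) (p : E -> R)
    (C : set (E * R)) :
  sublinear p ->
  C (0, 0) ->
  (forall c r d s, C (c, r) -> C (d, s) -> C (c + d, r + s)) ->
  (forall t c r, 0 <= t -> C (c, r) -> C (t *: c, t * r)) ->
  (forall c r, C (c, r) -> r <= p c) ->
  exists q : E -> R, [/\ sublinear q, forall x, q x <= p x
    & forall c r, C (c, r) -> q (- c) <= - r].
Proof.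
move=> sp C0 CD CZ Cp.
pose Q := [set (fun x => p (x + cr.1) - cr.2) | cr in C].
have Qlb x : has_lbound [set q x | q in Q].
  exists (- p (- x)) => _ [_ [[c r] Ccr <-] <-] /=.
  have := sublinear_ge c x sp; rewrite [c + x]addrC; have := Cp _ _ Ccr; lra.
have infle x c r : C (c, r) -> inf [set q x | q in Q] <= p (x + c) - r.
  move=> Ccr; apply: ge_inf => //.
  by exists (fun x => p (x + c) - r) => //; exists (c, r).
exists (fun x => inf [set q x | q in Q]); split=> [|x|c r Ccr].
- apply: inf_sublinear => //.
  + by exists (fun x => p (x + 0) - 0), (0, 0).
  + move=> _ _ x y [[c r] Ccr <-] [[d s] Cds <-] /=.
    exists (fun x => p (x + (c + d)) - (r + s)).
      by exists (c + d, r + s) => //; exact: CD.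
    by have := sp.1 (x + c) (y + d); rewrite addrACA; lra.
  + move=> _ t x [[c r] Ccr <-] t0 /=.
    exists (fun x => p (x + t *: c) - t * r).
      by exists (t *: c, t * r) => //; exact: CZ.
    by have := sp.2 t (x + c) t0; rewrite scalerDr mulrBr; lra.
- by have := infle x _ _ C0; rewrite addr0 subr0.
- apply: le_trans (infle (- c) _ _ Ccr) _.
  by rewrite addNr; have := sublinear_le0 sp; lra.
Qed.

(** Zorn's lemma for the reverse pointwise order.  The infimum of a chain is
    again sublinear, since of two members the smaller one can serve in the
    subadditivity estimate, and it is finite because every sublinear [q <= p]
    satisfies [- p (- x) <= q x]. *)
Lemma exists_minimal_sublinear (R : realType) (E : lmodType R) (p : E -> R) :
  sublinear p ->
  exists q : E -> R, [/\ sublinear q, forall x, q x <= p x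
    & forall q', sublinear q' -> (forall x, q' x <= q x) ->
      forall x, q x <= q' x].
Proof.
move=> sp.
pose T := {q : E -> R | sublinear q /\ forall x, q x <= p x}.
pose bounded q sq qp : T := exist _ q (conj sq qp).
pose below (s t : T) := `[< forall x, sval t x <= sval s x >].
have [|||[q [sq qp]] qmin] := @ZL_preorder T (bounded p sp (fun=> lexx _)) below.
- by move=> t; apply/asboolP.
- move=> r s t /asboolP rs /asboolP st; apply/asboolP => x.
  exact: le_trans (st x) (rs x).
- move=> A Atot.
  have [[a0 Aa0]|A0] := pselect (A !=set0); last first.
    exists (bounded p sp (fun=> lexx _)) => s As.
    by exfalso; apply: A0; exists s.
  pose Q := [set sval a | a in A].
  have Qlb x : has_lbound [set q x | q in Q].
    exists (- p (- x)) => _ [_ [[q [sq qp]] Aq <-] <-] /=.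
    have := sublinear_geN x sq; have := qp (- x); lra.
  have infle x a : A a -> inf [set q x | q in Q] <= sval a x.
    by move=> Aa; apply: ge_inf => //; exists (sval a) => //; exists a.
  have sQ : sublinear (fun x => inf [set q x | q in Q]).
    apply: inf_sublinear => //; first by exists (sval a0), a0.
      move=> _ _ x y [a Aa <-] [b Ab <-].
      have [/asboolP ab|/asboolP ba] := Atot _ _ Aa Ab.
        exists (sval b); first by exists b.
        by apply: le_trans ((svalP b).1.1 x y) _; rewrite lerD2r.
      exists (sval a); first by exists a.
      by apply: le_trans ((svalP a).1.1 x y) _; rewrite lerD2l.
    move=> _ t x [a Aa <-] t0; exists (sval a); first by exists a.
    exact: (svalP a).1.2.
  have Qp x : inf [set q x | q in Q] <= p x.
    exact: le_trans (infle x _ Aa0) ((svalP a0).2 x).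
  exists (bounded _ sQ Qp) => a Aa; apply/asboolP => x /=; exact: infle.
exists q; split=> // q' sq' q'q x.
have q'p y : q' y <= p y by exact: le_trans (q'q y) (qp y).
have /asboolP := qmin (bounded q' sq' q'p) (asboolT q'q); exact.
Qed.

(** A minimal sublinear [q] coincides with its tilt along the ray through
    [(y, q y)], so [q] is odd; odd sublinear functions are linear. *)
Theorem hahn_banach_sublinear (R : realType) (E : lmodType R) (p : E -> R) :
  sublinear p -> exists g : {linear E -> R^o}, forall x, g x <= p x.
Proof.
move=> /exists_minimal_sublinear[q [sq qp qmin]].
have qN y : q (- y) <= - q y.
  pose C := [set cr : E * R |
    exists2 t, 0 <= t & cr = (t *: y, t * q y)].
  have [||||q' [sq' q'q Cq']] := @tilt_sublinear _ _ q C sq.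
  - by exists 0 => //; rewrite scale0r mul0r.
  - move=> _ _ _ _ [t t0 [-> ->]] [s s0 [-> ->]]; exists (t + s).
      exact: addr_ge0.
    by rewrite scalerDl mulrDl.
  - move=> s _ _ s0 [t t0 [-> ->]]; exists (s * t); first exact: mulr_ge0.
    by rewrite scalerA mulrA.
  - move=> _ _ [t t0 [-> ->]].
    by rewrite (sublinearZ _ sq).
  apply: le_trans (qmin _ sq' q'q (- y)) _.
  by apply: Cq'; exists 1; rewrite ?scale1r ?mul1r.
have {}qN y : q (- y) = - q y.
  by apply/eqP; rewrite eq_le qN /=; have := sublinear_geN y sq; lra.
have qZ t x : q (t *: x) = t * q x.
  have [t0|/ltW t0] := leP 0 t; first exact: sublinearZ.
  by rewrite -[in LHS](opprK t) scaleNr qN sublinearZ ?oppr_ge0// mulNr opprK.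
have qD x y : q (x + y) = q x + q y.
  apply/eqP; rewrite eq_le sq.1 /=.
  by have := sublinear_ge x y sq; rewrite qN opprK.
have qlin : linear (q : E -> R^o) by move=> t x y; rewrite qD qZ.
pose qm := GRing.isLinear.Build R E R^o *:%R q qlin.
pose g : {linear E -> R^o} := HB.pack q qm.
by exists g.
Qed.

(** Hahn-Banach applied to the tilt of [p] along [C]: a linear function below the
    tilt is below [p], and by oddness above the second components on [C]. *)
Theorem mazur_orlicz_cone (R : realType) (E : lmodType R) (p : E -> R)
    (C : set (E * R)) :
  sublinear p ->
  C (0, 0) ->
  (forall c r d s, C (c, r) -> C (d, s) -> C (c + d, r + s)) ->
  (forall t c r, 0 <= t -> C (c, r) -> C (t *: c, t * r)) ->
  (forall c r, C (c, r) -> r <= p c) ->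
  exists g : {linear E -> R^o}, (forall x, g x <= p x) /\
    (forall c r, C (c, r) -> r <= g c).
Proof.
move=> sp C0 CD CZ Cp.
have [q [sq qp Cq]] := tilt_sublinear sp C0 CD CZ Cp.
have [g gq] := hahn_banach_sublinear sq.
exists g; split=> [x|c r Ccr]; first exact: le_trans (gq x) (qp x).
by have := le_trans (gq (- c)) (Cq _ _ Ccr); rewrite linearN lerN2.
Qed.

(** * Ekeland's variational principle *)

(** The point [y] covers at least half of the distance from [phi x] to the
    supremum of [phi] on [S], which is what makes the iteration in
    [ekeland_maximal] exhaust that distance in the limit. *)
Lemma half_improvement (R : realType) (T : Type) (S : set T) (phi : T -> R)
    (x : T) :
  has_ubound [set phi y | y in S] -> S x ->
  exists2 y, S y & forall z, S z -> phi z <= 2 * phi y - phi x.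
Proof.
move=> Sub Sx; set M := sup [set phi y | y in S].
have leM z : S z -> phi z <= M by move=> Sz; apply: ub_le_sup => //; exists z.
have [xM|Mx] := ltP (phi x) M; last first.
  by exists x => // z /leM; lra.
have [||_ [y Sy <-] My] := @sup_adherent _ [set phi y | y in S] ((M - phi x) / 2).
- by rewrite divr_gt0// subr_gt0.
- by split=> //; exists (phi x), x.
exists y => // z /leM zM; move: My; rewrite -/M; lra.
Qed.

(** The relation [eps * `|x - y| <= phi y - phi x] is a preorder on [D]; [S x] is
    the set of points of [D] above [x].  Moving repeatedly from [u n] to a point
    of [S (u n)] that covers half of the possible increase of [phi], the values
    [phi (u n)] increase to a limit, which makes [u] a Cauchy sequence.  Its
    limit [x1] is above all [u n], and nothing strictly above [x1] is left,
    because the possible increase of [phi] over [S (u n)] tends to 0. *)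
Theorem ekeland_maximal (R : realType) (X : completeNormedModType R)
    (D : set X) (phi : X -> R) (eps : R) (x0 : X) :
  closed D -> continuous phi -> has_ubound [set phi x | x in D] ->
  0 < eps -> D x0 ->
  exists x1, [/\ D x1, eps * `|x0 - x1| <= phi x1 - phi x0 &
    forall y, D y -> phi y <= phi x1 + eps * `|x1 - y|].
Proof.
move=> clD cphi [M Mphi] eps0 Dx0.
have phiM x : D x -> phi x <= M by move=> Dx; apply: Mphi; exists x.
pose S x := [set y | D y /\ eps * `|x - y| <= phi y - phi x].
have Strans x y z : S x y -> S y z -> S x z.
  move=> [Dy xy] [Dz yz]; split=> //.
  by have := ler_wpM2l (ltW eps0) (ler_distD y x z); rewrite mulrDr; lra.
have Srefl x : D x -> S x x by move=> Dx; split; rewrite // !subrr normr0 mulr0.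
have next_ex x : exists y, D x ->
    S x y /\ forall z, S x z -> phi z <= 2 * phi y - phi x.
  have [Dx|nDx] := pselect (D x); last by exists x.
  have [|y Sy ymax] := @half_improvement R X (S x) phi x _ (Srefl x Dx).
    by exists M => _ [y [Dy _] <-]; exact: phiM.
  by exists y.
have [next nextP] := choice next_ex.
pose u n := iter n next x0.
have Du n : D (u n).
  by elim: n => //= n Dn; have [[]] := nextP _ Dn.
have Suk n k : S (u n) (u (n + k)%N).
  elim: k => [|k IH]; first by rewrite addn0; exact: Srefl.
  rewrite addnS; apply: Strans IH _.
  by have [] := nextP _ (Du (n + k)%N).
have Su n m : (n <= m)%N -> S (u n) (u m) by move=> /subnKC <-.
have phiu_nd : nondecreasing_seq (phi \o u).
  move=> n m /Su[_ nm]; rewrite /= -subr_ge0; apply: le_trans nm.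
  by rewrite mulr_ge0// ltW.
have phiu_ub : has_ubound (range (phi \o u)).
  by exists M => _ [n _ <-]; exact: phiM.
have phiu_cvg := nondecreasing_cvgn phiu_nd phiu_ub.
set L := sup _ in phiu_cvg.
have phiuL n : phi (u n) <= L by apply: ub_le_sup => //; exists n.
have u_cvg : cvgn u.
  apply/cauchy_cvgP/cauchy_exP => e e0.
  have /cvgrPdist_lt/(_ (eps * e)) := phiu_cvg.
  rewrite mulr_gt0// => /(_ isT)[N _ NL].
  exists (u N); exists N => // n /= Nn; rewrite -ball_normE /=.
  rewrite -(ltr_pM2l eps0); apply: le_lt_trans (Su _ _ Nn).2 _.
  have := NL N (leqnn N); rewrite /= => /(le_lt_trans (ler_norm _)).
  by have := phiuL n; lra.
have /cvg_ex[x1 ux1] := u_cvg.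
have Dx1 : D x1.
  by apply: (closed_cvg D clD _ _ ux1); exact: nearW.
have phix1 : phi x1 = L.
  apply: (@cvg_unique _ _ (phi (u n) @[n --> \oo])) => //.
  by apply: continuous_cvg => //; exact: cphi.
have Sux1 n : S (u n) x1.
  split=> //; rewrite phix1.
  have dist_cvg : eps * `|u n - u m| @[m --> \oo] --> eps * `|u n - x1|.
    apply: cvgM; first exact: cvg_cst.
    by apply: cvg_norm; apply: cvgB => //; exact: cvg_cst.
  apply: (cvgr_to_le dist_cvg); exists n => // m /= nm.
  by apply: le_trans (Su _ _ nm).2 _; rewrite lerD2r.
exists x1; split=> //; first exact: (Sux1 0%N).2.
move=> y Dy; rewrite leNgt; apply/negP => yx1.
have Sx1y : S x1 y by split=> //; lra.
(* A counterexample [y] lies in [S x1]; having no larger value than [x1], it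
   would satisfy [eps * `|x1 - y| < 0]. *)
suff : phi y <= phi x1.
  have : 0 <= eps * `|x1 - y| by rewrite mulr_ge0// ltW.
  lra.
have bound n : phi y <= 2 * phi (u n.+1) - phi (u n).
  by have [_] := nextP _ (Du n); apply; exact: Strans (Sux1 n) Sx1y.
have bound_cvg : 2 * phi (u n.+1) - phi (u n) @[n --> \oo] --> 2 * L - L.
  apply: cvgB => //; apply: cvgM; first exact: cvg_cst.
  by move: phiu_cvg; rewrite -cvg_shiftS.
rewrite phix1 (_ : L = 2 * L - L); last by lra.
by apply: (cvgr_to_ge bound_cvg); exact: nearW.
Qed.

(** * The Bishop-Phelps lemma *)

Lemma conv_in_convex (R : realType) (X : lmodType R) (D : set X) (a b : R)
    (x y : X) :
  convex_set (D : set (convex_lmodType X)) -> 0 <= a -> 0 <= b -> a + b = 1 ->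
  D x -> D y -> D (a *: x + b *: y).
Proof.
move=> cD a0 b0 ab1 Dx Dy.
have a01 : Itv.spec (@Itv.num_sem R) (Itv.Real `[0%Z, 1%Z]) a.
  rewrite /= /Itv.num_sem /= in_itv /= a0 ger0_real //=; lra.
have := cD x y (Itv.mk a01) (mem_set Dx) (mem_set Dy).
by rewrite inE; have <- : 1 - a = b by lra.
Qed.

(** A one-sided bound is enough, since [g] is odd and the norm is even. *)
Lemma dominated_continuous (R : realType) (X : normedModType R)
    (g : {linear X -> R^o}) (k : R) :
  (forall x, g x <= k * `|x|) ->
  continuous g /\ forall x, `|g x| <= k * `|x|.
Proof.
move=> gk.
have gabs x : `|g x| <= k * `|x|.
  rewrite ler_norml gk andbT lerNl.
  by have := gk (- x); rewrite linearN normrN.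
split=> //; apply/linear_bounded_continuous/bounded_funP => r.
exists (`|k| * r) => x xr; apply: le_trans (gabs x) _.
by apply: le_trans (ler_wpM2l (normr_ge0 k) xr); rewrite ler_wpM2r// ler_norm.
Qed.

Lemma dual_norm_le (R : realType) (X : normedModType R) (g : X -> R) (k : R) :
  0 <= k -> (forall x, `|g x| <= k * `|x|) -> dual_norm g <= k.
Proof.
move=> k0 gk; apply: ge_sup; first by exists `|g 0|, 0; rewrite //= normr0.
move=> _ [x /= x1 <-]; apply: le_trans (gk x) _.
by rewrite -[leRHS]mulr1 ler_wpM2l.
Qed.

Lemma continuous_bounded_on (R : realType) (X : normedModType R) (D : set X)
    (f : {linear X -> R^o}) :
  bounded_set D -> continuous f -> exists M, forall x, D x -> `|f x| <= M.
Proof.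
move=> /pinfty_ex_gt0[k _ Dk] /linear_bounded_continuous/bounded_funP/(_ k)[M fM].
by exists M => x Dx; apply: fM; exact: Dk.
Qed.

(** The Ekeland point [x1] satisfies [t * (f x - f x1) <= eps * `|t *: (x1 - x)|]
    for all [x] in [D] and [t >= 0], which is the hypothesis under which
    [mazur_orlicz_cone] separates by a linear function. *)
Lemma bishop_phelps (R : realType) (X : completeNormedModType R) (D : set X)
    (f : {linear X -> R^o}) (eps : R) (x0 : X) :
  closed D -> convex_set (D : set (convex_lmodType X)) ->
  continuous f -> has_ubound [set f x | x in D] -> 0 < eps -> D x0 ->
  exists (g : {linear X -> R^o}) (x1 : X),
    [/\ D x1, forall x, g x <= eps * `|x|,
        eps * `|x0 - x1| <= f x1 - f x0
      & forall x, D x -> f x + g x <= f x1 + g x1].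
Proof.
move=> clD cD cf fD eps0 Dx0.
have [x1 [Dx1 x01 x1max]] := ekeland_maximal clD cf fD eps0 Dx0.
have sp : sublinear (fun x : X => eps * `|x|).
  split=> [x y|t x t0]; first by rewrite -mulrDr ler_wpM2l ?(ltW eps0)// ler_normD.
  by rewrite normrZ (ger0_norm t0) mulrCA.
pose C := [set cr : X * R | exists t x,
  [/\ 0 <= t, D x & cr = (t *: (x1 - x), t * (f x - f x1))]].
have [||||g [gp gC]] := @mazur_orlicz_cone R X _ C sp.
- by exists 0, x1; rewrite scale0r mul0r.
- move=> _ _ _ _ [t [x [t0 Dx [-> ->]]]] [s [y [s0 Dy [-> ->]]]].
  have [ts0|ts0] := ltP 0 (t + s); last first.
    exists 0, x1; split=> //.
    have -> : t = 0 by lra.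
    have -> : s = 0 by lra.
    by rewrite !scale0r !mul0r !addr0.
  have tsN0 : t + s != 0 by rewrite gt_eqF.
  (* [x1 - _] is affine: the sum of two multiples of [x1 - x] and [x1 - y] is
     a multiple of [x1 - z], with [z] the weighted mean of [x] and [y]. *)
  exists (t + s), ((t / (t + s)) *: x + (s / (t + s)) *: y); split.
  + exact: ltW.
  + apply: conv_in_convex => //; try by rewrite divr_ge0// ltW.
    by rewrite -mulrDl divff.
  + congr (_, _).
      rewrite [in RHS]scalerBr [in RHS]scalerDr !scalerA ![_ * (_ / _)]mulrC.
      rewrite !divfK// !scalerBr scalerDl opprD; exact: addrACA.
    rewrite linearD !linearZ /= /GRing.scale /=.
    by field.
- move=> t _ _ t0 [s [x [s0 Dx [-> ->]]]]; exists (t * s), x.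
  by split; rewrite ?mulr_ge0// scalerA mulrA.
- move=> _ _ [t [x [t0 Dx [-> ->]]]].
  rewrite normrZ (ger0_norm t0) mulrCA ler_wpM2l//.
  by have := x1max _ Dx; lra.
exists g, x1; split=> // x Dx.
have : f x - f x1 <= g (x1 - x).
  by apply: gC; exists 1, x; rewrite scale1r mul1r.
by rewrite linearB/=; lra.
Qed.

(** * Attaining the supremum of the absolute value *)

Lemma attains_sup_abs_at_max (R : realType) (X : normedModType R) (D : set X)
    (h : X -> R) (x1 : X) :
  D x1 -> (forall x, D x -> `|h x| <= `|h x1|) -> attains_sup_abs_at D h x1.
Proof.
move=> Dx1 hmax; split=> //; apply/eqP; rewrite eq_le; apply/andP; split.
  apply: ub_le_sup; last by exists x1.
  by exists `|h x1| => _ [x Dx <-]; exact: hmax.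
by apply: ge_sup; [exists `|h x1|, x1 | move=> _ [x Dx <-]; exact: hmax].
Qed.

Lemma le_sup_abs (R : realType) (X : normedModType R) (D : set X)
    (f : {linear X -> R^o}) (x : X) :
  bounded_set D -> continuous f -> D x -> f x <= sup_abs D f.
Proof.
move=> bD cf Dx; apply: le_trans (ler_norm (f x)) _.
have [M fM] := continuous_bounded_on bD cf.
apply: ub_le_sup; last by exists x.
by exists M => _ [y Dy <-]; exact: fM.
Qed.

Lemma has_ubound_continuous (R : realType) (X : normedModType R) (D : set X)
    (f : {linear X -> R^o}) :
  bounded_set D -> continuous f -> has_ubound [set f x | x in D].
Proof.
move=> bD cf; have [M fM] := continuous_bounded_on bD cf.
by exists M => _ [x Dx <-]; apply: le_trans (ler_norm _) (fM x Dx).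
Qed.

(** Two applications of [bishop_phelps].  The first makes [h = f + g] attain its
    maximum at [x1].  If [- h x2 > h x1] for some [x2] in [D], the second one,
    applied to [- h] from [x2], changes values on [D] by at most half of the gap
    [eta = - h x2 - h x1]: the new maximum is at least [- h x2 - eta / 2], and
    the opposite functional is at most [h x1 + eta / 2], the same number. *)
Lemma bishop_phelps_abs (R : realType) (X : completeNormedModType R)
    (D : set X) (f : {linear X -> R^o}) (eps : R) :
  D !=set0 -> bounded_set D -> closed D ->
  convex_set (D : set (convex_lmodType X)) -> continuous f -> 0 < eps ->
  exists xs : {linear X -> R^o},
    (forall x, `|xs x| <= eps * `|x|) /\ attains_sup_abs D (f \+ xs).
Proof.
move=> [x0 Dx0] bD clD cD cf eps0.
have fD := has_ubound_continuous bD cf.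
have e20 : 0 < eps / 2 by rewrite divr_gt0.
have [g [x1 [Dx1 g_le _ gmax]]] := bishop_phelps clD cD cf fD e20 Dx0.
have [cg g_abs] := dominated_continuous g_le.
have [no_opp|] := pselect (forall x, D x -> - (f x + g x) <= f x1 + g x1).
  exists g; split.
    move=> x; apply: le_trans (g_abs x) _; rewrite ler_wpM2r//; lra.
  exists x1; apply: attains_sup_abs_at_max => // x Dx /=.
  apply: le_trans (ler_norm _).
  by rewrite ler_norml gmax// andbT lerNl no_opp.
move=> /existsNP[x2 /not_implyP[Dx2 /negP]]; rewrite -ltNge => gap.
have [M M0 DM] := pinfty_ex_gt0 bD.
have {}DM x : D x -> `|x| <= M by exact: DM.
pose eta := - (f x2 + g x2) - (f x1 + g x1).
have eta0 : 0 < eta by rewrite subr_gt0.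
(* The first bound keeps the total perturbation below [eps], the second keeps
   the new one below [eta / 2] on [D], where norms are at most [M]. *)
pose e' := Num.min (eps / 2) (eta / 2 / M).
have e'0 : 0 < e' by rewrite lt_min e20 !divr_gt0.
have e'eps : e' <= eps / 2 by rewrite ge_min lexx.
have e'M : e' * M <= eta / 2 by rewrite -ler_pdivlMr// ge_min lexx orbT.
pose f' : {linear X -> R^o} := \- (f \+ g).
have cf' : continuous f'.
  by move=> x; apply: cvgN; apply: cvgD; [exact: cf|exact: cg].
have f'D := has_ubound_continuous bD cf'.
have [g' [x3 [Dx3 g'_le _ g'max]]] := bishop_phelps clD cD cf' f'D e'0 Dx2.
have [_ g'_abs] := dominated_continuous g'_le.
have g'D x : D x -> `|g' x| <= eta / 2.
  move=> Dx; apply: le_trans (g'_abs x) _; apply: le_trans _ e'M.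
  by rewrite ler_wpM2l ?(ltW e'0)// DM.
have f'E x : f' x = - (f x + g x) by [].
exists (g \- g' : {linear X -> R^o}); split.
  move=> x /=; apply: le_trans (ler_normB _ _) _.
  have := g_abs x; have := g'_abs x.
  have := ler_wpM2r (normr_ge0 x) e'eps.
  by lra.
exists x3; apply: attains_sup_abs_at_max => // x Dx.
have hE y : (f \+ (g \- g')) y = - (f' y + g' y).
  by rewrite f'E /=; lra.
rewrite !hE !normrN; apply: le_trans (ler_norm _).
rewrite ler_norml g'max// andbT.
have := g'max _ Dx2; have := gmax _ Dx; rewrite !f'E.
have := g'D _ Dx; have := g'D _ Dx2; rewrite !ler_norml /eta.
by move=> /andP[? ?] /andP[? ?]; lra.
Qed.

Theorem theorem2p5 (R : realType) (X : completeNormedModType R) (D : set X)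
    (D_nonempty : D !=set0) (D_bounded : bounded_set D) (D_closed : closed D)
    (D_convex : convex_set (D : set (convex_lmodType X)))
    (f : {linear X -> R^o}) (f_cont : continuous f)
    (eps : R) (eps_gt0 : 0 < eps) :
  (exists xs : {linear X -> R^o},
      [/\ continuous xs, dual_norm xs <= eps & attains_sup_abs D (f \+ xs)])
  /\
  (symmetric_set D ->
   forall (x0 : X) (delta : R),
     D x0 -> 0 < delta -> sup_abs D f - delta / 2 < f x0 ->
     exists (xs : {linear X -> R^o}) (x1 : X),
       [/\ continuous xs, dual_norm xs <= eps, `|x0 - x1| <= delta / eps
         & attains_sup_abs_at D (f \+ xs) x1]).
Proof.
split=> [|symD x0 delta Dx0 delta0 fx0].
  have [xs [xs_abs attained]] :=
    bishop_phelps_abs D_nonempty D_bounded D_closed D_convex f_cont eps_gt0.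
  have xs_le x : xs x <= eps * `|x| by apply: le_trans (ler_norm _) (xs_abs x).
  exists xs; split=> //; first by have [] := dominated_continuous xs_le.
  exact: dual_norm_le (ltW eps_gt0) xs_abs.
have fD := has_ubound_continuous D_bounded f_cont.
have [g [x1 [Dx1 g_le near_x0 gmax]]] :=
  bishop_phelps D_closed D_convex f_cont fD eps_gt0 Dx0.
have [cg g_abs] := dominated_continuous g_le.
have DN x : D x -> D (- x) by move=> Dx; rewrite symD; exists x.
exists g, x1; split=> //; first exact: dual_norm_le (ltW eps_gt0) g_abs.
  (* [eps * `|x0 - x1| <= f x1 - f x0 < delta / 2]. *)
  rewrite ler_pdivlMr// mulrC.
  by have := le_sup_abs D_bounded f_cont Dx1; lra.
apply: attains_sup_abs_at_max => // x Dx /=; apply: le_trans (ler_norm _).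
rewrite ler_norml gmax// andbT lerNl.
by have := gmax _ (DN _ Dx); rewrite !linearN; lra.
Qed.
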